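(* For every $n\in\mathbb N$ the Hall–Littlewood–Schubert series satisfies, as an identity of rational functions in $\mathbb{Q}(Y,\mathbf X)$, \[ \mathsf{HLS}_n(Y^{-1},\mathbf X^{-1})=(-1)^n\,Y^{-\binom{n}{2}}\,X_{[n]}\cdot \mathsf{HLS}_n(Y,\mathbf X), \] where $\mathbf X^{-1}=(X_C^{-1})_{\varnothing\neq C\subseteq[n]}$.
   Context: Let $n\in\mathbb N$ and $[n]=\{1,\dots,n\}$. $\mathrm{SSYT}_n$ denotes the set of semistandard Young tableaux with entries in $[n]$ (a Young diagram of a partition filled with entries weakly increasing along rows and strictly increasing down columns), including the empty tableau. $T_{ij}$ denotes the entry of $T$ in row $i$, column $j$. A tableau is identified with the sequence $(C_1,\dots,C_\ell)$ of its columns, where $C_j\subseteq[n]$ is the set of entries of column $j$; ''$C\in T$'' means $C$ is one of the columns of $T$ (products over $C\in T$ are taken over columns, with multiplicity). $T$ is reduced if its columns are pairwise distinct; $\mathrm{rSSYT}_n$ is the (finite) set of reduced tableaux. For $T=(C_1,\dots,C_\ell)$ and $i,j\in\mathbb N$ such that the cells $(i,j)$ and $(i,j+1)$ both exist, the leg set is $\mathrm{Leg}^+_T(i,j)=C_j\cap\{T_{ij},T_{ij}+1,\dots,T_{i,j+1}\}$ if $T_{i,j+1}\notin C_j$, and $\varnothing$ otherwise (and $\varnothing$ if one of the two cells does not exist). The leg polynomial is $\Phi_T(Y)=\prod_{(i,j):\,\mathrm{Leg}^+_T(i,j)\neq\varnothing}\bigl(1-Y^{\#\mathrm{Leg}^+_T(i,j)}\bigr)\in\mathbb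 Z[Y]$. With independent variables $Y$ and $\mathbf X=(X_C)_{\varnothing\neq C\subseteq[n]}$, the Hall–Littlewood–Schubert series is \[\mathsf{HLS}_n(Y,\mathbf X)=\sum_{T\in\mathrm{rSSYT}_n}\Phi_T(Y)\prod_{C\in T}\frac{X_C}{1-X_C}\in\mathbb Z[Y](\mathbf X).\] *)

(* Defs.v *)
From mathcomp Require Import all_boot all_order all_algebra.
Set Implicit Arguments. Unset Strict Implicit. Unset Printing Implicit Defensive.
Import GRing.Theory.
Local Open Scope ring_scope.

(* [n] = {1,...,n} is represented by 'I_n via i |-> i+1.
   A column is a subset C : {set 'I_n}; a tableau is the sequence of its
   columns (C_1, ..., C_l), here indexed from 0. *)

Section Tableaux.
Variable n : nat.

Definition col_entries (C : {set 'I_n}) : seq nat :=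
  sort leq [seq (val c).+1 | c <- enum C].

Definition column (T : seq {set 'I_n}) (j : nat) : {set 'I_n} := nth set0 T j.

Definition entry (T : seq {set 'I_n}) (i j : nat) : nat :=
  nth 0 (col_entries (column T j)) i.

Definition cell (T : seq {set 'I_n}) (i j : nat) : bool :=
  (j < size T)%N && (i < #|column T j|)%N.

(* semistandard Young tableau with entries in [n], given by its columns:
   all columns nonempty, column lengths weakly decreasing (Young diagram),
   rows weakly increasing; columns strictly increase by construction. *)
Definition is_SSYT (T : seq {set 'I_n}) : bool :=
  all (fun C => C != set0) T &&
  [forall j : 'I_(size T),
     ((j.+1 < size T)%N ==>
       ((#|column T j.+1| <= #|column T j|)%N &&
        [forall i : 'I_n, (i < #|column T j.+1|)%N ==>
           (entry T i j <= entry T i j.+1)%N]))].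

Definition is_rSSYT (T : seq {set 'I_n}) : bool := is_SSYT T && uniq T.

Definition leg_size (T : seq {set 'I_n}) (i j : nat) : nat :=
  if cell T i j && cell T i j.+1 &&
     ((entry T i j.+1) \notin col_entries (column T j))
  then #|[set c in column T j |
           (entry T i j <= (val c).+1 <= entry T i j.+1)%N]|
  else 0%N.

(* leg polynomial Phi_T evaluated at y; rows i < n suffice since every
   column has at most n cells *)
Definition legPhi (K : fieldType) (T : seq {set 'I_n}) (y : K) : K :=
  \prod_(j < size T) \prod_(i < n)
     (if leg_size T i j != 0%N then 1 - y ^+ leg_size T i j else 1).

(* Hall-Littlewood-Schubert series evaluated at (y, x).  A reduced tableau
   has at most 2^n - 1 columns (distinct nonempty subsets of [n]), so
   summing over tuples of length k < 2^n enumerates rSSYT_n exactly once. *)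
Definition HLS (K : fieldType) (y : K) (x : {set 'I_n} -> K) : K :=
  \sum_(k < 2 ^ n) \sum_(t : k.-tuple {set 'I_n} | is_rSSYT t)
     legPhi t y * \prod_(C <- t) (x C / (1 - x C)).

End Tableaux.

(* Main.v *)
(* Write #C_{<d} for the number of elements of C below d.  For consecutive
   columns C, D the product of the leg factors is
     phi_y(C, D) = \prod_{d in D \ C} (1 - y^(#C_{<d} - #D_{<d})),
   and this expression vanishes on its own when (C, D) violates the tableau
   condition.  Hence HLS is a sum over chains with multiplicative weights: if
   f(C) sums the tableaux with first column C, then f is the unique solution of
   f(C) = x_C (phi_y f)(C), f(0) = 1, and HLS = (phi_y f)([n]).
   The reciprocity comes from the fact that phi_{1/y} and phi_y are inverse
   matrices up to a diagonal twist u(E) = \prod_{e in E} (- y^(e - n)):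
     \sum_E phi_{1/y}(C, E) u(E) phi_y(E, D) = [C = D] u(C).
   It implies that u(C) (phi_y f)(C) solves the system with y, x inverted, and
   u([n]) = (-1)^n y^(- n(n-1)/2). *)
Require Import Defs.
From mathcomp Require Import all_boot all_order all_algebra.
From mathcomp Require Import ring zify.
Set Implicit Arguments. Unset Strict Implicit. Unset Printing Implicit Defensive.
Import GRing.Theory.
Local Open Scope ring_scope.

Lemma big_ltS (R : Type) (idx : R) (op : Monoid.com_law idx) (n : nat)
    (k : 'I_n) (F : 'I_n -> R) :
  \big[op/idx]_(i < n | (i < k.+1)%N) F i
    = op (F k) (\big[op/idx]_(i < n | (i < k)%N) F i).
Proof.
rewrite (bigD1 k) //=; congr (op _ _); apply: eq_bigl => i.
by rewrite ltnS [(i < k)%N]ltn_neqAle andbC.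
Qed.

Lemma big_lt_all (R : Type) (idx : R) (op : R -> R -> R) (n : nat)
    (F : 'I_n -> R) :
  \big[op/idx]_(i < n | (i < n)%N) F i = \big[op/idx]_(i < n) F i.
Proof. by apply: eq_bigl => i; rewrite ltn_ord. Qed.

(** * Twisted inversion of the matrices [phi] *)

Section Duality.
Variables (K : fieldType) (n : nat).
Implicit Types (q z : K) (C D E : {set 'I_n}) (i : 'I_n) (k : nat).

Definition cnt C k : nat := (\sum_(i < n | (i < k)%N) (i \in C))%N.

Lemma cntS C i : cnt C i.+1 = ((i \in C) + cnt C i)%N.
Proof. exact: big_ltS. Qed.

Lemma cnt_all C : cnt C n = #|C|.
Proof. by rewrite /cnt big_lt_all -sum1_card [RHS]big_mkcond. Qed.

Lemma eq_cnt C D k :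
  (forall i, (i < k)%N -> (i \in C) = (i \in D)) -> cnt C k = cnt D k.
Proof. by move=> h; apply: eq_bigr => i /h ->. Qed.

Lemma leq_cnt C D k :
  (forall i, (i < k)%N -> i \in D -> i \in C) -> (cnt D k <= cnt C k)%N.
Proof.
move=> h; apply: leq_sum => i /h; case: (i \in D) => // -> //.
Qed.

(* The truncation-free form [q ^+ a / q ^+ b] of [q ^ (a - b)] is harmless when
   [a < b]: such a path has already met a factor with [a = b], which is zero. *)
Definition step_weight q C D i : K :=
  if (i \in D) && (i \notin C) then 1 - q ^+ cnt C i / q ^+ cnt D i else 1.

Definition phi q C D : K := \prod_(i < n) step_weight q C D i.

(* The product of these factors is [u(E)], with the power of [q] distributed
   over the positions [i] instead of over the elements of [E]. *)
Definition twist_factor q E i : K := (-1) ^+ (i \in E) / q ^+ cnt E i.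

Definition twist q E : K := \prod_(i < n) twist_factor q E i.

Definition dual_factor q C D E i : K :=
  step_weight q^-1 C E i * twist_factor q E i * step_weight q E D i.

(* [z] marks the number of entries of [E] among the first [k] letters. *)
Definition scan q C D k z : K :=
  \sum_(E : {set 'I_n} | E \subset [set i : 'I_n | (i < k)%N])
    (\prod_(i < n | (i < k)%N) dual_factor q C D E i) * z ^+ cnt E k.

Lemma sum_subset_ltS (k : 'I_n) (F : {set 'I_n} -> K) :
  \sum_(E : {set 'I_n} | E \subset [set i : 'I_n | (i < k.+1)%N]) F E
  = \sum_(E : {set 'I_n} | E \subset [set i : 'I_n | (i < k)%N]) (F E + F (k |: E)).
Proof.
have notin E : E \subset [set i : 'I_n | (i < k)%N] -> k \notin E.
  by move=> /subsetP h; apply/negP => /h; rewrite inE ltnn.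
have sub E : (E \subset [set i : 'I_n | (i < k)%N])
           = (E \subset [set i : 'I_n | (i < k.+1)%N]) && (k \notin E).
  apply/idP/andP => [sE|[/subsetP sE kE]].
    split; last exact: notin.
    by apply: subset_trans sE _; apply/subsetP => i; rewrite !inE => /ltnW.
  apply/subsetP => i iE; move: (sE _ iE); rewrite !inE ltnS leq_eqVlt.
  by case/orP => // /eqP/val_inj e; rewrite -e iE in kE.
rewrite big_split /= (bigID (fun E : {set 'I_n} => k \notin E)) /=.
congr (_ + _); first by apply: eq_bigl => E; rewrite sub.
rewrite (reindex_onto (fun E => k |: E) (fun E => E :\ k)) /=; last first.
  by move=> E /andP[_]; rewrite negbK => /setD1K.
apply: eq_bigl => E; rewrite sub subUset sub1set !inE eqxx ltnSn /= andbT.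
congr (_ && _); apply/eqP/idP => [<-|kE]; first by rewrite !inE eqxx.
exact: setU1K.
Qed.

(** The letter [k] either stays out of [E] or joins it. Either way its factors see the rest of [E]
    only through [q ^+ cnt E k], and dividing by that power amounts to replacing [z] by [z / q];
    hence the marker [z]. *)
Lemma scanS q C D (k : 'I_n) z : q != 0 ->
  scan q C D k.+1 z = (1 - z) * scan q C D k (z / q)
    + ((k \notin C)%:R * z / q ^+ cnt C k - (k \in D)%:R / q ^+ cnt D k)
      * scan q C D k z.
Proof.
move=> q0; rewrite /scan sum_subset_ltS !mulr_sumr -big_split /=.
apply: eq_bigr => E /subsetP sE.
have kE : k \notin E by apply/negP => /sE; rewrite inE ltnn.
have mE (i : 'I_n) : (i < k)%N -> (i \in k |: E) = (i \in E).
  by move=> ik; rewrite !inE; case: eqP => // e; rewrite e ltnn in ik.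
have cE (i : nat) : (i <= k)%N -> cnt (k |: E) i = cnt E i.
  by move=> ik; apply: eq_cnt => j ji; apply: mE; apply: leq_trans ik.
have pE : \prod_(i < n | (i < k)%N) dual_factor q C D (k |: E) i
        = \prod_(i < n | (i < k)%N) dual_factor q C D E i.
  apply: eq_bigr => i ik.
  by rewrite /dual_factor /step_weight /twist_factor mE ?cE // ltnW.
rewrite !big_ltS pE; set P := \prod_(i < n | _) _.
rewrite !cntS cE // (negbTE kE) !inE eqxx /= add0n add1n.
rewrite /dual_factor /step_weight /twist_factor !inE eqxx (negbTE kE) /= cE //.
rewrite andbF andbT expr0 expr1 exprS expr_div_n !exprVn invrK.
have qe m : q ^+ m != 0 by rewrite expf_neq0.
move: (qe (cnt E k)) (qe (cnt C k)) (qe (cnt D k)).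
move: (q ^+ cnt E k) (q ^+ cnt C k) (q ^+ cnt D k) (z ^+ cnt E k) => a b c d.
by move=> a0 b0 c0; case: (k \in C); case: (k \in D) => /=; field;
  rewrite ?a0 ?b0 ?c0.
Qed.

(** The q-Pochhammer symbol $(z;q^{-1})_h$. *)
Definition qprod q h z : K := \prod_(j < h) (1 - z / q ^+ j).

Lemma qprodS q h z : qprod q h.+1 z = qprod q h z * (1 - z / q ^+ h).
Proof. exact: big_ord_recr. Qed.

(** Both sides are [qprod q h.+1 z], with its first or its last factor split off. *)
Lemma qprod_shift q h z : q != 0 ->
  (1 - z) * qprod q h (z / q) = (1 - z / q ^+ h) * qprod q h z.
Proof.
move=> q0; rewrite [RHS]mulrC -qprodS /qprod.
rewrite big_ord_recl /= expr0 divr1; congr (_ * _); apply: eq_bigr => i _.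
by rewrite /bump add1n exprS invfM mulrA.
Qed.

(* The partial sums over [E] stay q-binomial products, because a letter of
   [D] outside [C] makes the sum vanish for good; at [k = n] and [z = 1] the
   first factor of [qprod] is zero. *)
Lemma scan_closed q C D k : q != 0 -> (k <= n)%N -> exists c : K,
  [/\ forall z, scan q C D k z
        = c * z ^+ cnt D k * qprod q (cnt C k - cnt D k) z,
      c != 0 -> forall i, (i < k)%N -> i \in D -> i \in C
    & (forall i, (i < k)%N -> (i \in C) = (i \in D)) ->
        c = \prod_(i < n | (i < k)%N) twist_factor q C i].
Proof.
move=> q0; elim: k => [_|k IH kn].
  exists 1; split => // [z|_]; last by rewrite big_pred0.
  have c0 E : cnt E 0 = 0%N by rewrite /cnt big_pred0.
  rewrite !c0 /qprod big_ord0 expr0 !mulr1 /scan (big_pred1 set0).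
    by rewrite big_pred0 // c0 mulr1.
  have -> : [set i : 'I_n | (i < 0)%N] = set0 by apply/setP => i; rewrite !inE.
  by move=> E; rewrite subset0.
have [c [Hc Hsub Heq]] := IH (ltnW kn).
pose i := Ordinal kn; have ik : k = i by [].
have agreeS : (forall j : 'I_n, (j < k.+1)%N -> (j \in C) = (j \in D)) ->
    forall j : 'I_n, (j < k)%N -> (j \in C) = (j \in D).
  by move=> h j jk; apply/h/ltnW.
have [c0|cN0] := eqVneq c 0.
  exists 0; split=> [z||h]; last first.
  - by rewrite ik big_ltS /= -Heq; [rewrite c0 mulr0|exact: agreeS].
  - by rewrite eqxx.
  - by rewrite ik scanS // !Hc c0 !(mul0r, mulr0) addr0.
have {}Hsub := Hsub cN0; have le := leq_cnt Hsub.
(* Put $d$ = [cnt D k] and $h$ = [cnt C k - cnt D k]. By [scanS] and [qprod_shift] the letter [i]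
   contributes the factor $q^{-d}(1-zq^{-h})+[i\notin C]\,zq^{-d-h}-[i\in D]\,q^{-d}$. This is
   $-zq^{-d-h}$ if [i] lies in both sets, $0$ if only in [D], $q^{-d}(1-zq^{-h})$ if only in [C],
   and $q^{-d}$ if in neither. The constants are collected here; the rest extends the power of [z]
   or [qprod]. *)
exists (c * if i \in D then (if i \in C then - (q ^+ cnt C k)^-1 else 0)
        else (q ^+ cnt D k)^-1).
split=> [z||h]; last first.
- rewrite ik big_ltS /= -Heq; last exact: agreeS.
  rewrite -(h i) // mulrC; congr (_ * _).
  rewrite /twist_factor -(eq_cnt (agreeS h)).
  by case: (i \in C); rewrite ?expr0 ?expr1 ?mulN1r ?mul1r.
- move=> nz j; rewrite ltnS leq_eqVlt => /orP[/eqP jk|/Hsub//] jD.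
  have ji : j = i by apply: val_inj.
  by move: nz; rewrite -ji jD; case: (j \in C) => //; rewrite mulr0 eqxx.
rewrite ik scanS // !Hc !cntS -ik.
set h := (cnt C k - cnt D k)%N.
have eC : cnt C k = (cnt D k + h)%N by rewrite /h subnKC.
have -> : (1 - z) * (c * (z / q) ^+ cnt D k * qprod q h (z / q))
        = c * (z / q) ^+ cnt D k * ((1 - z / q ^+ h) * qprod q h z).
  by rewrite -qprod_shift //; ring.
have qe m : q ^+ m != 0 by rewrite expf_neq0.
rewrite eC exprD expr_div_n.
have e0 : ((0 + (cnt D k + h)) - (0 + cnt D k) = h)%N by lia.
have e1 : ((1 + (cnt D k + h)) - (1 + cnt D k) = h)%N by lia.
have e2 : ((1 + (cnt D k + h)) - (0 + cnt D k) = h.+1)%N by lia.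
case: (i \in C); case: (i \in D) => /=; rewrite ?e0 ?e1 ?e2 ?qprodS ?add0n ?add1n ?exprS;
  move: (qe (cnt D k)) (qe h) => a0 b0; field; by rewrite ?a0 ?b0.
Qed.

Lemma phi_dual q C D : q != 0 ->
  \sum_E phi q^-1 C E * twist q E * phi q E D = (C == D)%:R * twist q C.
Proof.
move=> q0; have [c [Hc Hsub Heq]] := scan_closed C D q0 (leqnn n).
transitivity (scan q C D n 1).
  apply: eq_big => [E|E _].
    by apply/esym/subsetP => i _; rewrite inE ltn_ord.
  by rewrite big_lt_all expr1n mulr1 /phi /twist -!big_split.
rewrite Hc expr1n mulr1 !cnt_all; have [eCD|neq] := eqVneq C D.
  rewrite Heq => [|i _]; last by rewrite eCD.
  by rewrite eCD subnn /qprod big_ord0 mulr1 mul1r big_lt_all.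
have [->|/Hsub sDC] := eqVneq c 0; first by rewrite !mul0r.
have: D \proper C.
  rewrite properEneq eq_sym neq; apply/subsetP => i; exact: sDC.
move/proper_card; rewrite -subn_gt0 mul0r.
by case: (_ - _)%N => // h _; rewrite /qprod big_ord_recl expr0 divr1 subrr mul0r mulr0.
Qed.

Lemma twist_setT q : twist q setT = (-1) ^+ n * q ^- 'C(n, 2).
Proof.
rewrite /twist.
transitivity (\prod_(i < n) (-1 * q^-1 ^+ i)).
  apply: eq_bigr => i _; rewrite /twist_factor inE expr1 exprVn; congr (_ / q ^+ _).
  transitivity (\sum_(j < n | (j < i)%N) 1)%N; first by apply: eq_bigr => j _; rewrite inE.
  by rewrite -(big_ord_widen n (fun=> 1%N)) ?sum1_card ?card_ord // ltnW.
rewrite big_split /= prodr_const card_ord; congr (_ * _).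
by rewrite -exprVn prodrXr -triangular_sum big_mkord.
Qed.

End Duality.

(** * Dominance of columns, and legs as factors of [phi] *)

Section Columns.
Variable n : nat.
Implicit Types (C D : {set 'I_n}) (T : seq {set 'I_n}).

Lemma perm_col_entries C : perm_eq (col_entries C) [seq (val c).+1 | c <- enum C].
Proof. exact/permPl/perm_sort. Qed.

Lemma size_col_entries C : size (col_entries C) = #|C|.
Proof. by rewrite (perm_size (perm_col_entries C)) size_map cardE. Qed.

Lemma mem_col_entries C (i : 'I_n) : (i.+1 \in col_entries C) = (i \in C).
Proof.
rewrite (perm_mem (perm_col_entries C)) -mem_enum.
by rewrite (mem_map (f := fun c : 'I_n => (val c).+1)) // => a b [] /val_inj.
Qed.

Lemma count_col_entries C (p : pred nat) :
  count p (col_entries C) = #|[set c in C | p (val c).+1]|.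
Proof.
rewrite (permP (perm_col_entries C)) count_map -sum1_count big_enum_cond /=.
by rewrite -sum1_card; apply: eq_bigl => c; rewrite inE.
Qed.

Lemma count_leq_col_entries C k : count (leq^~ k) (col_entries C) = cnt C k.
Proof.
rewrite count_col_entries /cnt -sum1_card big_mkcond [RHS]big_mkcond.
by apply: eq_bigr => c _; rewrite inE /=; case: (c \in C); case: (c < k)%N.
Qed.

Lemma sorted_col_entries C : sorted ltn (col_entries C).
Proof.
rewrite ltn_sorted_uniq_leq sort_sorted; last exact: leq_total.
rewrite sort_uniq map_inj_uniq ?enum_uniq // => a b [] /val_inj //.
Qed.

(** In an increasing list the entries at most [k] form an initial segment. *)
Lemma sorted_nth_leq (s : seq nat) i k : sorted ltn s -> (i < size s)%N ->
  (nth 0 s i <= k)%N = (i < count (leq^~ k) s)%N.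
Proof.
elim: s i => // a s IH i pas; have sas := path_sorted pas.
case: i => [_|i lt_i] /=.
  case: (leqP a k) => //= ka; apply/esym/negbTE; rewrite -leqNgt leqn0 add0n.
  rewrite -leqn0 leqNgt -has_count; apply/hasPn => b bs; rewrite -ltnNge.
  by apply: ltn_trans ka _; move: (order_path_min ltn_trans pas) => /allP; apply.
rewrite IH //; case: (leqP a k) => //= ka; rewrite add0n.
have -> : count (leq^~ k) s = 0%N; last by rewrite !ltn0.
apply/eqP; rewrite -leqn0 leqNgt -has_count; apply/hasPn => b bs; rewrite -ltnNge.
by apply: ltn_trans ka _; move: (order_path_min ltn_trans pas) => /allP; apply.
Qed.

Lemma col_nth_leq C i k : (i < #|C|)%N ->
  (nth 0 (col_entries C) i <= k)%N = (i < cnt C k)%N.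
Proof.
move=> iC; rewrite sorted_nth_leq ?sorted_col_entries ?size_col_entries //.
by rewrite count_leq_col_entries.
Qed.

Lemma col_nth C i : (i < #|C|)%N ->
  exists2 c : 'I_n, c \in C
    & nth 0 (col_entries C) i = c.+1 /\ i = cnt C c.
Proof.
move=> iC; have: nth 0 (col_entries C) i \in col_entries C.
  by rewrite mem_nth // size_col_entries.
rewrite (perm_mem (perm_col_entries C)) => /mapP[c]; rewrite mem_enum => cC e.
exists c => //; split=> //.
have := leqnn c.+1; rewrite -{1}e col_nth_leq // cntS cC.
have := ltnn c; rewrite -[(c < c)%N]/(c.+1 <= c)%N -{1}e col_nth_leq //.
by move=> /negbT; rewrite -leqNgt => h1 h2; apply/eqP; rewrite eqn_leq h1 andbT.
Qed.

Lemma cnt_leq_card C k : (cnt C k <= #|C|)%N.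
Proof.
rewrite -cnt_all /cnt big_lt_all big_mkcond leq_sum // => i _.
by case: ifP.
Qed.

(** The tableau condition on adjacent columns in terms of prefix counts, the form in which [phi]
    detects it. The case [k = n] compares the column lengths. *)
Definition dominates C D : bool :=
  [forall k : 'I_n.+1, (cnt D k <= cnt C k)%N].

Lemma dominatesP C D :
  reflect (forall k, (k <= n)%N -> (cnt D k <= cnt C k)%N) (dominates C D).
Proof.
apply: (iffP forallP) => [h k kn|h k]; last by apply: h; rewrite -ltnS.
by have := h (Ordinal (kn : (k < n.+1)%N)).
Qed.

Lemma cnt_set0 k : cnt (set0 : {set 'I_n}) k = 0%N.
Proof. by rewrite /cnt big1 // => i _; rewrite inE. Qed.

Lemma dominates0 C : dominates C set0.
Proof. by apply/forallP => k; rewrite cnt_set0. Qed.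

Lemma dominatesE C D : dominates C D =
  (#|D| <= #|C|)%N && [forall i : 'I_n, (i < #|D|)%N ==>
    (nth 0 (col_entries C) i <= nth 0 (col_entries D) i)%N].
Proof.
have cardn E : (#|E : {set 'I_n}| <= n)%N.
  by rewrite -[X in (_ <= X)%N](card_ord n) max_card.
apply/dominatesP/andP => [dom|[le /forallP h] k kn].
  have le : (#|D| <= #|C|)%N by rewrite -!cnt_all; apply: dom.
  split=> //; apply/forallP => i; apply/implyP => iD.
  have [d dD [-> ei]] := col_nth iD.
  have iC := leq_trans iD le.
  rewrite col_nth_leq //; apply: leq_trans (dom _ (ltn_ord d)).
  by rewrite cntS dD -ei.
(* The last letter of [D] below [k] sits in row [r]; comparing the columns in that row alone gives
   the bound at [k]. *)
case e: (cnt D k) => [|r] //.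
have rD : (r < #|D|)%N by rewrite -e cnt_leq_card.
have rn : (r < n)%N := leq_trans rD (cardn D).
have /implyP/(_ rD) := h (Ordinal rn) => /= hr.
have rC := leq_trans rD le; rewrite -col_nth_leq //; apply: leq_trans hr _.
by rewrite col_nth_leq // e.
Qed.

(** As [k] grows by one, [cnt C k - cnt D k] drops by at most one. To become negative it must leave
    the value 0 at a letter of [D] outside [C], where the factor of [phi] is [1 - 1]. *)
Lemma phi_dominates (K : fieldType) (q : K) C D :
  q != 0 -> phi q C D != 0 -> dominates C D.
Proof.
move=> q0 /prodf_neq0 nz; apply/dominatesP; elim=> [|k IH] kn.
  by rewrite /cnt !big_pred0.
pose i := Ordinal kn; have := nz i isT; have := IH (ltnW kn).
rewrite -[k]/(val i) !cntS /step_weight.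
case: (i \in D); case: (i \in C) => //=; rewrite ?add0n ?add1n // ?ltnS //.
- rewrite leq_eqVlt => /orP[/eqP -> |//].
  by rewrite divff ?subrr ?eqxx // expf_neq0.
- by move=> /leqW.
Qed.

(** A rank for dominance: it strictly decreases between distinct columns, because the prefix counts
    determine the set. *)
Definition height C : nat := (\sum_(k < n.+1) cnt C k)%N.

Lemma dominates_height C D : dominates C D -> C != D -> (height D < height C)%N.
Proof.
move=> /forallP dom neq.
have le : (height D <= height C ?= iff [forall k : 'I_n.+1, cnt D k == cnt C k])%N.
  by apply: leqif_sum => k _; split.
rewrite ltn_neqAle !le andbT; apply: contra neq => /forallP h.
have {}h k : (k <= n)%N -> cnt C k = cnt D k.
  by move=> kn; have := h (Ordinal (kn : (k < n.+1)%N)) => /eqP.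
apply/eqP/setP => i; have := h _ (ltn_ord i); rewrite !cntS (h i) ?(ltnW (ltn_ord i)) //.
by move/addIn; case: (i \in C); case: (i \in D).
Qed.

(** A letter [d] in row [i] of the right column $D$ has $i$ = [cnt D d]. If [d] is not in the left
    column $C$, the leg consists of the letters of $C$ below [d] except those in the [i] rows above,
    so its size is [cnt C d - cnt D d]. The predecessor undoes the shift between letters and
    entries. *)
Lemma leg_row (K : fieldType) (y : K) T j (i : 'I_n) :
  y != 0 -> (j.+1 < size T)%N -> dominates (column T j) (column T j.+1) ->
  (if leg_size T i j != 0%N then 1 - y ^+ leg_size T i j else 1)
  = if (i < #|column T j.+1|)%N
    then let d := (nth 0 (col_entries (column T j.+1)) i).-1 in
         if d.+1 \notin col_entries (column T j)
         then 1 - y ^+ cnt (column T j) d / y ^+ cnt (column T j.+1) d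
         else 1
    else 1.
Proof.
move=> y0 jT dom; rewrite /leg_size /cell jT (ltnW jT) /entry /=.
set C := column T j in dom *; set D := column T j.+1 in dom *.
have [iD|_] := boolP (i < #|D|)%N; last by rewrite !andbF eqxx.
have := dom; rewrite dominatesE => /andP[le /forallP/(_ i)]; rewrite iD /= => hi.
have iC := leq_trans iD le; rewrite iC /=.
have [d dD [ed ei]] := col_nth iD; rewrite ed /= in hi *; rewrite mem_col_entries.
have [dC|_] := boolP (d \notin C); last by rewrite eqxx.
have -> : #|[set c in C | (nth 0 (col_entries C) i <= c.+1 <= d.+1)%N]|
        = (cnt C d - i)%N.
  have [c cC [ec eic]] := col_nth iC; rewrite ec in hi *.
  have -> : cnt C d = cnt C d.+1 by rewrite cntS (negbTE dC).
  rewrite eic -!count_leq_col_entries !count_col_entries.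
  rewrite -cardsDS; last first.
    apply/subsetP => a; rewrite !inE => /andP[-> h]; exact: leq_trans h (ltnW hi).
  apply: eq_card => a; rewrite !inE; case: (a \in C); rewrite ?andbF //=.
  by rewrite -ltnNge ltnS andbC.
(* Dominance at [d.+1] makes the leg nonempty, so the test [leg_size != 0] succeeds. *)
have lt : (i < cnt C d)%N.
  have := elimT (dominatesP _ _) dom d.+1 (ltn_ord d).
  by rewrite !cntS dD (negbTE dC) -ei.
rewrite subn_eq0 leqNgt lt /= {1}ei -expfB_cond ?(negbTE y0) //.
by rewrite -ei ltnW.
Qed.

Lemma leg_column (K : fieldType) (y : K) T j :
  y != 0 -> (j < size T)%N -> dominates (column T j) (column T j.+1) ->
  \prod_(i < n)
    (if leg_size T i j != 0%N then 1 - y ^+ leg_size T i j else 1)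
  = phi y (column T j) (column T j.+1).
Proof.
move=> y0; rewrite leq_eqVlt => /orP[/eqP jT|jT] dom.
  (* To the right of the last column stands the default [set0]: there are no legs and no letters,
     and both sides are 1. *)
  rewrite /column [nth _ _ j.+1]nth_default ?jT //.
  rewrite /phi !big1 // => i _; rewrite ?/step_weight ?inE //.
  by rewrite /leg_size /cell jT ltnn andbF eqxx.
under eq_bigr => i _ do rewrite (leg_row _ y0 jT dom).
set C := column T j; set D := column T j.+1.
rewrite -big_mkcond /=.
have cardn : (#|D| <= n)%N by rewrite -[X in (_ <= X)%N](card_ord n) max_card.
pose g d := if d \notin col_entries C
            then 1 - y ^+ cnt C d.-1 / y ^+ cnt D d.-1 else 1.
transitivity (\prod_(v <- col_entries D) g v).
  rewrite (big_nth 0) size_col_entries big_mkord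
    (big_ord_widen n (fun i => g (nth 0 (col_entries D) i))) //.
  by apply: eq_bigr => i iD; rewrite /g; have [d _ [-> _]] := col_nth iD.
rewrite (perm_big _ (perm_col_entries D)) big_map big_enum /=.
rewrite /phi big_mkcond; apply: eq_bigr => i _.
by rewrite /step_weight /g mem_col_entries; case: (i \in D).
Qed.

End Columns.

(** * Reduced tableaux as weighted chains of columns *)

Section Chains.
Variables (K : fieldType) (n : nat) (y : K) (X : {set 'I_n} -> K).
Hypothesis y_neq0 : y != 0.
Implicit Types (C D : {set 'I_n}) (t : seq {set 'I_n}).

Lemma is_SSYT_cons C t :
  is_SSYT (C :: t) = [&& C != set0, dominates C (head set0 t) & is_SSYT t].
Proof.
have adj (T : seq {set 'I_n}) (j : 'I_(size T)) :
    ((j.+1 < size T)%N ==>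
       ((#|column T j.+1| <= #|column T j|)%N &&
        [forall i : 'I_n, (i < #|column T j.+1|)%N ==>
           (entry T i j <= entry T i j.+1)%N]))
    = dominates (column T j) (column T j.+1).
  rewrite -dominatesE; case: ltnP => [//|le]; rewrite implyFb.
  by rewrite [column T j.+1]nth_default ?dominates0.
have all_adj (T : seq {set 'I_n}) : is_SSYT T = all (fun C => C != set0) T &&
    [forall j : 'I_(size T), dominates (column T j) (column T j.+1)].
  by rewrite /is_SSYT; congr (_ && _); apply: eq_forallb => j; apply: adj.
have -> : dominates C (head set0 t) = dominates (column (C :: t) 0) (column (C :: t) 1).
  by rewrite /column /= nth0.
rewrite !all_adj /= -andbA; congr (_ && _); rewrite andbCA; congr (_ && _).
apply/forallP/andP => [h|[h0 /forallP h] j].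
  by split; [exact: (h ord0)|apply/forallP => j; apply: (h (lift ord0 j))].
by case: (unliftP ord0 j) => [i|] ->; [apply: h|apply: h0].
Qed.

Lemma rSSYT_height C t :
  is_rSSYT (C :: t) -> all (fun D => height D < height C)%N t.
Proof.
elim: t C => //= D t IH C /andP[].
rewrite is_SSYT_cons /= inE negb_or => /and3P[_ dom ssyt].
case/andP=> /andP[neq _] /andP[Dt ut].
have lt := dominates_height dom neq; rewrite lt /=.
have /IH : is_rSSYT (D :: t) by rewrite /is_rSSYT ssyt /= Dt.
by apply: sub_all => E; move/ltn_trans; apply.
Qed.

(** Heights strictly decrease along a reduced tableau, so distinctness need only be checked between
    neighbours. *)
Lemma is_rSSYT_cons C t : is_rSSYT (C :: t) =
  [&& C != set0, C != head set0 t, dominates C (head set0 t) & is_rSSYT t].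
Proof.
apply/idP/and4P => [/andP[]|[C0 neq dom /andP[ssyt ut]]].
  rewrite is_SSYT_cons /= => /and3P[C0 -> ssyt] /andP[Ct ut].
  rewrite C0 /is_rSSYT ssyt ut; split=> //.
  by case: t Ct {ssyt ut} => //= D t; rewrite inE negb_or => /andP[].
rewrite /is_rSSYT is_SSYT_cons C0 dom ssyt /= ut andbT.
case: t neq dom ssyt ut => //= D t neq dom ssyt ut.
rewrite inE negb_or neq /=; apply/negP => Ct.
have /rSSYT_height/allP/(_ _ Ct) : is_rSSYT (D :: t) by rewrite /is_rSSYT ssyt.
by rewrite ltnNge ltnW // dominates_height.
Qed.

(** Dominance is not tested: the zeros of [phi] enforce it. *)
Fixpoint chain_weight t : K :=
  if t is C :: t' then
    if (C != set0) && (C != head set0 t')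
    then X C * phi y C (head set0 t') * chain_weight t' else 0
  else 1.

Lemma chain_weightE t : chain_weight t =
  if is_rSSYT t then legPhi t y * \prod_(C <- t) X C else 0.
Proof.
elim: t => [|C t IH].
  rewrite /is_rSSYT /is_SSYT /= big_nil /legPhi big_ord0 mulr1.
  by case: forallP => // [[]] [].
rewrite is_rSSYT_cons /= IH big_cons; case: eqP => //= _; case: eqP => //= _.
have [dom|ndom] := boolP (dominates C (head set0 t)); last first.
  have [->|/(phi_dominates y_neq0)] := eqVneq (phi y C (head set0 t)) 0.
    by rewrite mulr0 mul0r.
  by rewrite (negbTE ndom).
case: ifP => _ /=; last by rewrite mulr0.
rewrite /legPhi /= big_ord_recl (@leg_column n K y (C :: t) 0) //.
by rewrite /column /= nth0; ring.
Qed.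

Lemma sum_tupleS (T : finType) k (F : seq T -> K) :
  \sum_(t : k.+1.-tuple T) F t = \sum_(C : T) \sum_(t : k.-tuple T) F (C :: t).
Proof.
rewrite pair_big /= (reindex (fun p : T * k.-tuple T => [tuple of p.1 :: p.2])) //.
exists (fun t : k.+1.-tuple T => (thead t, [tuple of behead t])) => [[C t]|t] _.
  by congr (_, _); apply: val_inj.
by rewrite [RHS]tuple_eta; apply: val_inj.
Qed.

(** The empty tableau is filed under [set0], which gives the boundary value 1 there. *)
Definition level_sum k C : K :=
  \sum_(t : k.-tuple {set 'I_n} | head set0 t == C) chain_weight t.

Definition chain_sum C : K := \sum_(k < 2 ^ n) level_sum k C.

Lemma level_sum0 C : level_sum 0 C = (C == set0)%:R.
Proof.
rewrite /level_sum big_mkcond (big_pred1 [tuple]) /=; last first.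
  by move=> t; rewrite [t]tuple0; apply/esym/eqP.
by rewrite eq_sym; case: eqP.
Qed.

Lemma level_sumS k C : level_sum k.+1 C =
  if C != set0 then X C * \sum_(D | D != C) phi y C D * level_sum k D else 0.
Proof.
rewrite /level_sum big_mkcond.
rewrite (sum_tupleS k (fun t => if head set0 t == C then chain_weight t else 0)) /=.
rewrite (bigD1 C) //= eqxx [X in _ + X]big1 ?addr0 => [|D /negbTE neq]; last first.
  by apply: big1 => t _; rewrite neq.
case: ifP => C0 /=; last by apply: big1.
rewrite mulr_sumr -big_mkcond.
rewrite (partition_big (fun t : k.-tuple _ => head set0 t) (fun D => D != C)) /=.
  apply: eq_bigr => D neq; rewrite !mulr_sumr; apply: eq_big => t.
    by rewrite eq_sym andbC; case: eqP => // ->.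
  by move=> /andP[_ /eqP ->]; rewrite mulrA.
by move=> t; rewrite eq_sym.
Qed.

(** Pigeonhole: [2 ^ n] distinct nonempty columns together with [set0] would be too many subsets. *)
Lemma level_sum_top C : level_sum (2 ^ n) C = 0.
Proof.
apply: big1 => t _; rewrite chain_weightE; case: ifP => // /andP[/andP[/allP nz _] ut].
have /card_uniqP : uniq (set0 :: t).
  by rewrite /= ut andbT; apply/negP => /nz; rewrite eqxx.
have := max_card (mem (set0 :: t)) => /[swap] ->.
by rewrite /= size_tuple -cardsT -powersetT card_powerset cardsT card_ord ltnn.
Qed.

Lemma chain_sum0 : chain_sum set0 = 1.
Proof.
rewrite /chain_sum; case: (2 ^ n)%N (expn_gt0 2 n) => // m _.
rewrite big_ord_recl level_sum0 eqxx big1 ?addr0 // => k _.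
by rewrite level_sumS eqxx.
Qed.

Lemma chain_sumE C : C != set0 ->
  chain_sum C = X C * \sum_(D | D != C) phi y C D * chain_sum D.
Proof.
move=> C0; rewrite /chain_sum.
(* Level [2 ^ n] is zero, and so is level 0 for nonempty [C]; hence the range of lengths can be
   shifted by one. *)
transitivity (\sum_(k < (2 ^ n).+1) level_sum k C).
  by rewrite big_ord_recr /= level_sum_top addr0.
rewrite big_ord_recl level_sum0 (negbTE C0) add0r.
under [in RHS]eq_bigr => D _ do rewrite mulr_sumr.
rewrite exchange_big /= mulr_sumr; apply: eq_bigr => k _.
by rewrite level_sumS C0.
Qed.

Lemma sum_rSSYT :
  \sum_(k < 2 ^ n) \sum_(t : k.-tuple {set 'I_n} | is_rSSYT t)
     legPhi t y * \prod_(C <- t) X C = \sum_C chain_sum C.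
Proof.
rewrite /chain_sum exchange_big; apply: eq_bigr => k _; rewrite big_mkcond.
rewrite (partition_big (fun t : k.-tuple _ => head set0 t) xpredT) //=.
by apply: eq_bigr => C _; apply: eq_bigr => t _; rewrite chain_weightE.
Qed.

End Chains.

(** * The fixed-point system and its inversion *)

Section Reciprocity.
Variables (K : fieldType) (n : nat).
Implicit Types (C D E : {set 'I_n}) (y : K) (x f : {set 'I_n} -> K).

Lemma phi_id y C : phi y C C = 1.
Proof. by apply: big1 => i _; rewrite /step_weight andbN. Qed.

Lemma phi_setT y C : phi y setT C = 1.
Proof. by apply: big1 => i _; rewrite /step_weight inE andbF. Qed.

Definition hls_sum y x := chain_sum y (fun C => x C / (1 - x C)).

(** The row of [phi] at the full column consists of ones, so the total over all first columns is one
    entry of a matrix product. *)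
Lemma HLS_sum y x : y != 0 -> HLS y x = \sum_C phi y setT C * hls_sum y x C.
Proof.
by move=> y0; under eq_bigr => C _ do rewrite phi_setT mul1r; rewrite -sum_rSSYT.
Qed.

(** The diagonal term [D = C] absorbs the denominator [1 - x C], leaving a system in which [x C] can
    simply be inverted. *)
Lemma hls_sum_fix y x C : y != 0 -> C != set0 -> x C != 1 ->
  hls_sum y x C = x C * \sum_D phi y C D * hls_sum y x D.
Proof.
move=> y0 C0 x1; have := chain_sumE (fun C => x C / (1 - x C)) y0 C0.
rewrite -/(hls_sum y x) => e.
rewrite (bigD1 C) //= phi_id mul1r; set S := \sum_(D | _) _ in e *.
have nz : 1 - x C != 0 by rewrite subr_eq0 eq_sym.
by rewrite e; field.
Qed.

Lemma sum_phi_set0 y f : y != 0 -> \sum_D phi y set0 D * f D = f set0.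
Proof.
move=> y0; rewrite (bigD1 set0) //= phi_id mul1r big1 ?addr0 // => D D0.
have [->|/(phi_dominates y0) dom] := eqVneq (phi y set0 D) 0; first by rewrite mul0r.
have := elimT (dominatesP _ _) dom n (leqnn n).
by rewrite !cnt_all cards0 leqn0 cards_eq0 (negbTE D0).
Qed.

(** The system is triangular for [height], with diagonal coefficients [1 - x C], which are
    nonzero. *)
Lemma fix_unique y x f g : y != 0 -> (forall C, C != set0 -> x C != 1) ->
  f set0 = g set0 ->
  (forall C, C != set0 -> f C = x C * \sum_D phi y C D * f D) ->
  (forall C, C != set0 -> g C = x C * \sum_D phi y C D * g D) -> f =1 g.
Proof.
move=> y0 x1 e0 ef eg C; have [m] := ubnP (height C).
elim: m C => // m IH C; rewrite ltnS => le.
have [->//|C0] := eqVneq C set0.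
have := ef C C0; have := eg C C0.
rewrite (bigD1 C) // [in f C = _](bigD1 C) //= phi_id !mul1r.
have -> : \sum_(D | D != C) phi y C D * f D = \sum_(D | D != C) phi y C D * g D.
  apply: eq_bigr => D neq.
  have [->|/(phi_dominates y0) dom] := eqVneq (phi y C D) 0; first by rewrite !mul0r.
  rewrite IH //; apply: leq_trans le; apply: dominates_height dom _.
  by rewrite eq_sym.
set S := \sum_(D | _) _ => hg hf.
have nz : 1 - x C != 0 by rewrite subr_eq0 eq_sym x1.
apply: (mulfI nz); rewrite !mulrBl !mul1r {1}hf {1}hg; ring.
Qed.

End Reciprocity.

Theorem theoremA (K : fieldType) (n : nat) (y : K) (x : {set 'I_n} -> K) :
  (0 < n)%N ->
  y != 0 ->
  (forall C : {set 'I_n}, C != set0 -> x C != 0) ->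
  (forall C : {set 'I_n}, C != set0 -> x C != 1) ->
  HLS y^-1 (fun C => (x C)^-1)
    = (-1) ^+ n * y ^- 'C(n, 2) * x [set: 'I_n] * HLS y x.
Proof.
move=> n0 y0 x0 x1; have yV0 : y^-1 != 0 by rewrite invr_eq0.
(* For positive [n] the full column is nonempty, so the fixed-point equation holds at it. *)
have T0 : [set: 'I_n] != set0 by rewrite -card_gt0 cardsT card_ord.
pose Wf C := \sum_D phi y C D * hls_sum y x D.
have Wf_fix C : C != set0 -> hls_sum y x C = x C * Wf C.
  by move=> C0; apply: hls_sum_fix (x1 C C0).
pose g C := twist y C * Wf C.
have dual C : \sum_D phi y^-1 C D * g D = twist y C * hls_sum y x C.
  under eq_bigr => E _ do rewrite mulrA mulr_sumr.
  rewrite exchange_big /= (bigD1 C) //= [X in _ + X]big1 ?addr0.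
    under eq_bigr => E _ do rewrite mulrA.
    by rewrite -mulr_suml phi_dual // eqxx mul1r.
  move=> D /negbTE neq; under eq_bigr => E _ do rewrite mulrA.
  by rewrite -mulr_suml phi_dual // eq_sym neq !mul0r.
have eg : hls_sum y^-1 (fun C => (x C)^-1) =1 g.
  apply: (fix_unique (y := y^-1) (x := fun C => (x C)^-1)) => //.
  - by move=> C /x1; rewrite invr_eq1.
  - rewrite /hls_sum chain_sum0 /g /Wf sum_phi_set0 // /hls_sum chain_sum0 mulr1.
    rewrite /twist big1 // => i _; rewrite /twist_factor inE.
    by rewrite cnt_set0 expr0 divr1.
  - move=> C C0; apply: hls_sum_fix => //; rewrite invr_eq1; exact: x1.
  - by move=> C C0; rewrite dual Wf_fix // /g; field; apply: x0.
(* At the full column [dual] gives [twist] times [hls_sum]. One use of the fixed-point equation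
   there yields the factor [x [set: 'I_n]] and leaves [Wf], which is [HLS y x]. *)
rewrite !HLS_sum //; under eq_bigr => C _ do rewrite eg.
by rewrite dual Wf_fix // twist_setT mulrA.
Qed.
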